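(* Let $N\geq 2$, $\hbar = 2/\sqrt{N^2-1}$ and $\kappa\geq 0$. Let $W=W(t)\in\mathfrak{su}(N)$ be a solution of the Euler--Zeitlin equations with canonical dissipation $$\dot W + \frac{1}{\hbar}[W,P] = \frac{\kappa}{\hbar^2}[[W,P],P],\qquad -\Delta_N P = W,$$ where $P=P(t)\in\mathfrak{su}(N)$ and $\Delta_N$ is the quantized Laplacian. Then the energy $$H = \frac{2\pi}{N}\operatorname{tr}(W^\dagger P)$$ is conserved, i.e. $t\mapsto H$ is constant along the solution.
   Context: $\mathfrak{u}(N)$ is the space of skew-Hermitian complex $N\times N$ matrices, $\mathfrak{su}(N)$ its subspace of trace-free matrices, $[A,B]=AB-BA$, and ${}^\dagger$ is the conjugate transpose. Let $S_1,S_2,S_3\in\mathfrak{u}(N)$ be the generators of the irreducible $N$-dimensional unitary representation of $\mathfrak{so}(3)$, so $[S_1,S_2]=S_3$, $[S_2,S_3]=S_1$, $[S_3,S_1]=S_2$. The quantized (Hoppe--Yau) Laplacian is $$\Delta_N\colon\mathfrak{u}(N)\to\mathfrak{su}(N),\qquad \Delta_N P=\sum_{\alpha=1}^3[[P,S_\alpha],S_\alpha].$$ Its spectrum is $\{-\ell(\ell+1):\ell=0,\dots,N-1\}$ and its kernel is spanned by $\mathrm{i}I$, so that $\Delta_N$ restricts to an invertible operator on $\mathfrak{su}(N)$, and $P\in\mathfrak{su}(N)$ is uniquely determined by $W\in\mathfrak{su}(N)$ via $-\Delta_N P=W$. *)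

(* Defs.v *)
From mathcomp Require Import all_boot all_order all_algebra.
From mathcomp Require Import all_classical all_reals all_analysis.
From mathcomp Require Import complex spectral sesquilinear.

Set Implicit Arguments.
Unset Strict Implicit.
Unset Printing Implicit Defensive.

Import Order.TTheory GRing.Theory Num.Theory.
Import numFieldNormedType.Exports.

Local Open Scope classical_set_scope.
Local Open Scope ring_scope.
Local Open Scope complex_scope.
Local Open Scope sesquilinear_scope.

Section EulerZeitlin.
Variables (R : realType) (N : nat).
Implicit Types (A B P W : 'M[R[i]]_N) (S : 'I_3 -> 'M[R[i]]_N).

Definition lie A B : 'M[R[i]]_N := A *m B - B *m A.

(* u(N) *)
Definition skew_hermitian A : Prop := A ^t* = - A.

(* su(N) *)
Definition special_skew_hermitian A : Prop := skew_hermitian A /\ \tr A = 0.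

(* The row space of U encodes a subspace of column vectors. It is stable under
   right multiplication by the transpose of S a iff that subspace is invariant
   under v |-> S a *m v. *)
Definition irreducible_family S : Prop :=
  forall U : 'M[R[i]]_N,
    (forall a, stablemx U (S a)^T) -> U = 0 \/ row_full U.

(* Indices are added modulo 3, so the second clause is
   [S1, S2] = S3, [S2, S3] = S1, [S3, S1] = S2. *)
Definition so3_irreducible_generators S : Prop :=
  [/\ forall a, skew_hermitian (S a),
      forall a : 'I_3, lie (S a) (S (a + 1)) = S (a + 2)
    & irreducible_family S].

Definition quantized_laplacian S P : 'M[R[i]]_N :=
  \sum_(a < 3) lie (lie P (S a)) (S a).

Definition hbar : R := 2 / Num.sqrt (N%:R ^+ 2 - 1).

(* Derivative at t, relative to the time interval I (hence one-sided at an
   endpoint belonging to I). The alias R[i]^o only serves to select the norm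
   topology of the complex numbers, and the resulting one on matrices. *)
Definition has_derivative_within (I : set R) (W : R -> 'M[R[i]]_N) (t : R)
    (D : 'M[R[i]]_N) : Prop :=
  ((s - t)^-1)%:C *: (W s - W t) @[s --> within I t^']
    --> (D : 'M[R[i]^o]_N).

Definition euler_zeitlin_dissipative_solution S (kappa : R) (I : set R)
    (W P : R -> 'M[R[i]]_N) : Prop :=
  forall t, I t ->
    [/\ special_skew_hermitian (W t),
        special_skew_hermitian (P t),
        - quantized_laplacian S (P t) = W t
      & exists2 Wdot : 'M[R[i]]_N, has_derivative_within I W t Wdot
        & Wdot + (1 / hbar)%:C *: lie (W t) (P t)
          = (kappa / hbar ^+ 2)%:C *: lie (lie (W t) (P t)) (P t)].

Definition energy W P : R[i] := (2 * pi / N%:R)%:C * \tr (W ^t* *m P).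

End EulerZeitlin.

(* Main.v *)
Require Import Defs.
From HB Require Import structures.
From mathcomp Require Import all_boot all_order all_algebra.
From mathcomp Require Import all_classical all_reals all_analysis.
From mathcomp Require Import complex spectral sesquilinear.

(* Since Delta_N is symmetric for the trace pairing, the increment of
   tr (W P) between times t and s is exactly tr ((W s - W t) (P s + P t)).
   By Schur's lemma Delta_N is injective on trace-free matrices, so P is a linear
   function of W, hence continuous. The energy is therefore differentiable, with
   derivative proportional to tr (W' P); this vanishes because W' is a
   combination of the commutators [W, P] and [[W, P], P] and tr ([A, P] P) = 0. *)

Set Implicit Arguments.
Unset Strict Implicit.
Unset Printing Implicit Defensive.

Import Order.TTheory GRing.Theory Num.Theory.
Import numFieldNormedType.Exports.

Local Open Scope classical_set_scope.
Local Open Scope ring_scope.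
Local Open Scope complex_scope.
Local Open Scope sesquilinear_scope.

(** * Trace identities and injectivity of the quantized Laplacian *)

Section Algebra.
Variables (R : realType) (N : nat).
Implicit Types (A B C P Q : 'M[R[i]]_N) (S : 'I_3 -> 'M[R[i]]_N).

Lemma lieN A B : lie A B = - lie B A.
Proof. by rewrite /lie opprB. Qed.

Lemma mxtrace_lie A B : \tr (lie A B) = 0.
Proof. by rewrite /lie linearB /= mxtrace_mulC subrr. Qed.

(** Invariance of the trace form under the adjoint action; once expanded, it is cyclicity of the
    trace. *)
Lemma mxtrace_lie_mul A B C : \tr (lie A B *m C) = \tr (A *m lie B C).
Proof.
rewrite /lie mulmxBl mulmxBr !linearB /= !mulmxA; congr (_ - _).
by rewrite -[B *m A *m C]mulmxA [LHS]mxtrace_mulC.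
Qed.

Lemma mxtrace_lie_mul_self A P : \tr (lie A P *m P) = 0.
Proof. by rewrite mxtrace_lie_mul /lie subrr mulmx0 linear0. Qed.

Lemma lie_linear B : linear (fun A => lie A B).
Proof.
move=> k A C; rewrite /lie mulmxDl mulmxDr -scalemxAl -scalemxAr.
by rewrite scalerBr addrACA opprD.
Qed.

Lemma adjoint_lie A B : skew_hermitian B -> (lie A B)^t* = lie (A^t*) B.
Proof.
move=> hB; rewrite /lie linearB /= map_mxB !trmx_mul !map_mxM /= hB.
by rewrite mulNmx mulmxN opprK addrC.
Qed.

Lemma mxtrace_mul_adjoint_ge0 A : 0 <= \tr (A *m A^t*).
Proof.
apply: sumr_ge0 => i _; rewrite mxE; apply: sumr_ge0 => j _.
by rewrite !mxE mul_conjC_ge0.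
Qed.

Lemma mxtrace_mul_adjoint_eq0 A : \tr (A *m A^t*) = 0 -> A = 0.
Proof.
have ge0 i j : 0 <= A i j * (A^t*) j i by rewrite !mxE mul_conjC_ge0.
move=> /psumr_eq0P A0; apply/matrixP => i j; rewrite mxE.
have : (A *m A^t*) i i = 0.
  by apply: A0 => // k _; rewrite mxE; apply: sumr_ge0.
rewrite mxE => /psumr_eq0P Ai0.
have := Ai0 (fun k _ => ge0 i k) j isT.
by rewrite !mxE => /eqP; rewrite mul_conjC_eq0 => /eqP.
Qed.

Lemma quantized_laplacian_linear S : linear (quantized_laplacian S).
Proof.
move=> k A B; rewrite /quantized_laplacian scaler_sumr -big_split /=.
by apply: eq_bigr => a _; rewrite !lie_linear.
Qed.

Lemma mxtrace_quantized_laplacian S P : \tr (quantized_laplacian S P) = 0.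
Proof. by rewrite linear_sum big1 //= => a _; rewrite mxtrace_lie. Qed.

(** Summation by parts: moving the outer commutator across the trace pairing leaves a Dirichlet
    form, which cyclicity makes symmetric in [P] and [Q]. *)
Lemma mxtrace_quantized_laplacian_mul S P Q :
  \tr (quantized_laplacian S P *m Q) =
  - \sum_(a < 3) \tr (lie P (S a) *m lie Q (S a)).
Proof.
rewrite mulmx_suml linear_sum -sumrN; apply: eq_bigr => a _ /=.
by rewrite mxtrace_lie_mul [lie (S a) Q]lieN mulmxN linearN.
Qed.

Lemma quantized_laplacian_sym S P Q :
  \tr (quantized_laplacian S P *m Q) = \tr (P *m quantized_laplacian S Q).
Proof.
rewrite [RHS]mxtrace_mulC !mxtrace_quantized_laplacian_mul.
by congr (- _); apply: eq_bigr => a _; rewrite mxtrace_mulC.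
Qed.

Lemma quantized_laplacian_ker S P : (forall a, skew_hermitian (S a)) ->
  quantized_laplacian S P = 0 -> forall a, lie P (S a) = 0.
Proof.
move=> hS P0 a; apply: mxtrace_mul_adjoint_eq0.
have /eqP := mxtrace_quantized_laplacian_mul S P (P^t*).
rewrite P0 mul0mx linear0 eq_sym oppr_eq0 => /eqP /psumr_eq0P /=.
rewrite adjoint_lie //; apply => // b _.
by rewrite -adjoint_lie // mxtrace_mul_adjoint_ge0.
Qed.

(** Schur's lemma: an eigenvalue [l] of [P^T] exists over the algebraically closed [R[i]], and its
    eigenspace is stable under everything commuting with [P^T], hence full. The transposes match the
    row-vector convention for eigenspaces. *)
Lemma irreducible_family_commutant S P : (0 < N)%N -> irreducible_family S ->
  (forall a, lie P (S a) = 0) -> exists l, P = l%:M.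
Proof.
move=> N0 irrS PS; have [l] := eigenvalue_closed P^T N0.
rewrite /eigenvalue => lP; exists l.
have [a|El0|] := irrS (eigenspace P^T l); last 1 first.
- rewrite -sub1mx => /eigenspaceP; rewrite mul1mx scalemx1 => PT.
  by rewrite -[P]trmxK PT tr_scalar_mx.
- apply: comm_mx_stable_eigenspace; rewrite /comm_mx -!trmx_mul.
  by congr (_^T); have /eqP := PS a; rewrite subr_eq0 => /eqP.
- by rewrite El0 eqxx in lP.
Qed.

Lemma quantized_laplacian_inj S P : so3_irreducible_generators S ->
  quantized_laplacian S P = 0 -> \tr P = 0 -> P = 0.
Proof.
have [N0|N0] := posnP N.
  by move=> _ _ _; apply/matrixP => -[i iN]; exfalso; rewrite N0 in iN.
move=> [hS _ irrS] LP trP.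
have [l Pl] :=
  irreducible_family_commutant N0 irrS (quantized_laplacian_ker hS LP).
move: trP; rewrite Pl mxtrace_scalar => /eqP.
by rewrite mulrn_eq0 -[N == 0]negbK -lt0n N0 => /eqP ->; rewrite raddf0.
Qed.

(* Adding [\tr P] times the identity turns the Laplacian into an injective
   operator on all matrices, which has a matrix inverse. *)
Lemma quantized_laplacian_linv S : so3_irreducible_generators S ->
  exists G : 'M[R[i]]_(N * N), forall P, \tr P = 0 ->
    P = vec_mx (mxvec (quantized_laplacian S P) *m G).
Proof.
move=> hS; pose L P := quantized_laplacian S P + (\tr P)%:M.
have L_lin : linear L.
  move=> k A B; rewrite /L quantized_laplacian_linear linearP /= raddfD /=.
  by rewrite -scale_scalar_mx scalerDr addrACA.
pose HL := GRing.isLinear.Build _ _ _ _ L L_lin.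
pose L' : {linear 'M[R[i]]_N -> 'M[R[i]]_N} := HB.pack L HL.
have uL : lin_mx L' \in unitmx.
  rewrite -row_free_unit; apply/inj_row_free => v.
  rewrite -[v]vec_mxK; move: (vec_mx v) => P; rewrite mul_vec_lin /=.
  move=> /(canRL mxvecK); rewrite linear0 /L => LP.
  (* Commutators are trace-free, so [L P] has trace N times [\tr P]. If N = 0, the trace is an empty
     sum. *)
  have trP : \tr P = 0.
    have /eqP := congr1 mxtrace LP; rewrite linearD /=.
    rewrite mxtrace_quantized_laplacian add0r linear0 mxtrace_scalar.
    rewrite mulrn_eq0 => /predU1P[N0|/eqP//].
    by rewrite /mxtrace big1 // => -[i iN]; exfalso; rewrite N0 in iN.
  move: LP; rewrite trP raddf0 addr0 => LP.
  by rewrite (quantized_laplacian_inj hS LP trP) linear0.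
exists (invmx (lin_mx L')) => P trP.
have -> : quantized_laplacian S P = L' P by rewrite /= /L trP raddf0 addr0.
by rewrite -mul_vec_lin mulmxK // mxvecK.
Qed.

End Algebra.

(** * Functions with zero derivative on an interval are constant *)

Section Calculus.
Variable R : realType.

(** Mean value theorem on [s, t]: it asks only for continuity at the endpoints, where the limit
    along [I] may be one-sided. *)
Lemma within_derivative0_const (I : set R) (f : R -> R) : is_interval I ->
  (forall t, I t -> (s - t)^-1 * (f s - f t) @[s --> within I t^'] --> 0) ->
  forall s t, I s -> I t -> f s = f t.
Proof.
move=> itvI df.
suff lt_const s t : s < t -> I s -> I t -> f s = f t.
  move=> s t Is It; case: (ltgtP s t) => [||->//] st; first exact: lt_const.
  by apply/esym/lt_const.
move=> st Is It.
(* Since 0^-1 = 0, the quotient q x takes the value 0, its limit, at x itself. *)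
pose q x y := (y - x)^-1 * (f y - f x).
have qE x y : f y - f x = q x y * (y - x).
  rewrite /q mulrAC; have [->|yx] := eqVneq y x; first by rewrite !subrr mulr0.
  by rewrite mulVf ?mul1r // subr_eq0.
have stI x : x \in `[s, t] -> I x.
  by rewrite in_itv /= => /andP[sx xt]; apply: (itvI s t) => //; rewrite sx xt.
(* The limit passes from [I] to the segment and loses its puncture: at [y = x], membership in [U] is
   that of 0. *)
have q0 x : x \in `[s, t] -> q x y @[y --> within `[s, t] (nbhs x)] --> 0.
  move=> xst U U0.
  have qU : \forall y \near x, y != x -> I y -> U (q x y).
    exact: df x (stI x xst) U U0.
  suff : \forall y \near x, y \in `[s, t] -> U (q x y) by [].
  apply: filterS qU => y qU yst.
  have [->|yx] := eqVneq y x; last exact: qU yx (stI y yst).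
  by rewrite /q !subrr mulr0; exact: nbhs_singleton.
have fc : {within `[s, t], continuous f}.
  apply/subspace_continuousP => x xst.
  have fE : (fun y => f x + q x y * (y - x)) = f.
    by apply/funext => y; rewrite -qE addrC subrK.
  suff : (f x + q x y * (y - x)) @[y --> within `[s, t] (nbhs x)]
      --> f x + 0 * (x - x) by rewrite fE mul0r addr0.
  apply: cvgD; first exact: cvg_cst.
  apply: cvgM; first exact: q0.
  by apply: cvg_within_filter; apply: cvgB; [exact: cvg_id|exact: cvg_cst].
(* At an interior point the segment is a neighbourhood, so [q x] is a Carathéodory slope function
   with value 0 at [x]. *)
have fd x : x \in `]s, t[ -> is_derive x 1 f 0.
  move=> xst; apply/is_derive1_caratheodory; exists (q x).
  have xst' : x \in `[s, t] by exact: subset_itv_oo_cc xst.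
  have qxx : q x x = 0 by rewrite /q !subrr mulr0.
  split=> // U; rewrite /= qxx => U0.
  have qU : \forall y \near x, y \in `[s, t] -> U (q x y) by exact: q0.
  have : \forall y \near x, y \in `]s, t[ by exact: near_in_itvoo.
  by apply: filterS2 qU => y + yst; apply; exact: subset_itv_oo_cc yst.
have [c _] := MVT st fd fc.
by rewrite mul0r => /eqP; rewrite subr_eq0 => /eqP.
Qed.

Lemma normc_ge_Im (z : R[i]) : `|complex.Im z|%:C <= `|z|.
Proof. by rewrite normc_def lecR -sqrtr_sqr ler_wsqrtr // lerDr sqr_ge0. Qed.

Lemma within_derivative0_constC (I : set R) (f : R -> R[i]) : is_interval I ->
  (forall t, I t ->
    ((s - t)^-1)%:C * (f s - f t) @[s --> within I t^'] --> (0 : R[i]^o)) ->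
  forall s t, I s -> I t -> f s = f t.
Proof.
move=> itvI df s t Is It.
(* Here [p] stands for the real or the imaginary part: real-linear and bounded by the modulus, it
   inherits the zero limit. *)
have part (p : R[i] -> R) :
    (forall (k : R) z z', p (k%:C * (z - z')) = k * (p z - p z')) ->
    (forall z, `|p z|%:C <= `|z|) -> p (f s) = p (f t).
  move=> p_lin p_le.
  apply: (within_derivative0_const (f := p \o f) itvI _ Is It) => u Iu.
  apply/cvgr0Pnorm_lt => e e0.
  (* The norm of [R[i]] takes its values in [R[i]], so the real radius [e] is embedded as [e%:C]. *)
  have := cvgr0_norm_lt (V := R[i]^o) _ (df u Iu) e%:C; rewrite ltcR => /(_ _ e0).
  apply: filterS => y; rewrite -ltcR; apply: le_lt_trans.
  by rewrite /= -p_lin.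
apply/eqP; rewrite eq_complex; apply/andP; split; apply/eqP.
- by apply: part => [k [a b] [c d] /=|]; [rewrite mul0r subr0|exact: normc_ge_Re].
- by apply: part => [k [a b] [c d] /=|]; [rewrite mul0r addr0|exact: normc_ge_Im].
Qed.

Lemma real_complex_continuous : continuous (fun x : R => x%:C : R[i]^o).
Proof.
(* A positive element of [R[i]] has zero imaginary part, so the radius is the real number [e]. *)
move=> x; apply/cvgrPdist_lt => -[e b]; rewrite ltcE /= => /andP[/eqP -> e0].
have : \forall y \near x, `|x - y| < e by exact: (nbhsx_ballx x).
apply: filterS => y; rewrite -ltcR => /le_lt_trans; apply.
by rewrite -rmorphB normc_def /= expr0n addr0 sqrtr_sqr.
Qed.

End Calculus.

(** * Entrywise limits of matrix-valued functions *)

Section EntrywiseLimits.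
Context {R : realType} {T : Type} {F : set_system T} {FF : Filter F}.

(* Entrywise limits avoid the sup norm on matrices: the limit lemmas for sums and
   products then reduce to those in R[i]. *)
Definition cvg_entrywise m n (A : T -> 'M[R[i]]_(m, n)) (B : 'M[R[i]]_(m, n)) :=
  forall i j, A s i j @[s --> F] --> (B i j : R[i]^o).

Lemma cvg_entrywise_mulmx m n p (A : T -> 'M[R[i]]_(m, n))
    (B : T -> 'M[R[i]]_(n, p)) A0 B0 :
  cvg_entrywise A A0 -> cvg_entrywise B B0 ->
  cvg_entrywise (fun s => A s *m B s) (A0 *m B0).
Proof.
move=> AA BB i j; rewrite mxE.
have -> : (fun s => (A s *m B s) i j) = fun s => \sum_k A s i k * B s k j.
  by apply/funext => s; rewrite mxE.
by apply: (cvg_big (U := R[i]^o)) => [|k _]; [exact: add_continuous|exact: cvgM].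
Qed.

Lemma cvg_entrywiseD m n (A B : T -> 'M[R[i]]_(m, n)) A0 B0 :
  cvg_entrywise A A0 -> cvg_entrywise B B0 ->
  cvg_entrywise (fun s => A s + B s) (A0 + B0).
Proof.
move=> AA BB i j; rewrite mxE.
have -> : (fun s => (A s + B s) i j) = fun s => A s i j + B s i j.
  by apply/funext => s; rewrite mxE.
exact: (cvgD (V := R[i]^o)) (AA i j) (BB i j).
Qed.

Lemma cvg_entrywiseZ m n (k : T -> R[i]) (A : T -> 'M[R[i]]_(m, n)) k0 A0 :
  k s @[s --> F] --> (k0 : R[i]^o) -> cvg_entrywise A A0 ->
  cvg_entrywise (fun s => k s *: A s) (k0 *: A0).
Proof.
move=> kk AA i j; rewrite mxE.
have -> : (fun s => (k s *: A s) i j) = fun s => k s * A s i j.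
  by apply/funext => s; rewrite mxE.
exact: cvgM kk (AA i j).
Qed.

Lemma cvg_entrywise_cst m n (A : 'M[R[i]]_(m, n)) : cvg_entrywise (fun=> A) A.
Proof. by move=> i j; exact: (@cvg_cst R[i]^o). Qed.

Lemma cvg_entrywise_mxvec m n (A : T -> 'M[R[i]]_(m, n)) A0 :
  cvg_entrywise A A0 -> cvg_entrywise (fun s => mxvec (A s)) (mxvec A0).
Proof.
move=> AA i k; rewrite ord1; case/mxvec_indexP: k => i' j'; rewrite mxvecE.
have -> : (fun s => mxvec (A s) 0 (mxvec_index i' j')) = fun s => A s i' j'.
  by apply/funext => s; rewrite mxvecE.
exact: AA.
Qed.

Lemma cvg_entrywise_vec_mx m n (A : T -> 'rV[R[i]]_(m * n)) A0 :
  cvg_entrywise A A0 -> cvg_entrywise (fun s => vec_mx (A s)) (vec_mx A0).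
Proof.
move=> AA i j; rewrite mxE.
have -> : (fun s => vec_mx (A s) i j) = fun s => A s 0 (mxvec_index i j).
  by apply/funext => s; rewrite mxE.
exact: AA.
Qed.

Lemma cvg_entrywise_mxtrace n (A : T -> 'M[R[i]]_n) A0 :
  cvg_entrywise A A0 -> \tr (A s) @[s --> F] --> (\tr A0 : R[i]^o).
Proof.
by move=> AA; apply: (cvg_big (U := R[i]^o)) => [|k _]; [exact: add_continuous|exact: AA].
Qed.

Lemma cvg_entrywise_near m n (A B : T -> 'M[R[i]]_(m, n)) A0 :
  (\forall s \near F, A s = B s) -> cvg_entrywise A A0 -> cvg_entrywise B A0.
Proof.
move=> AB AA i j; apply: cvg_trans (AA i j); apply: near_eq_cvg.
by apply: filterS AB => s ->.
Qed.

End EntrywiseLimits.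

(** * Continuity of [P] and the derivative of the energy *)

Section EnergyConservation.
Variables (R : realType) (N : nat) (S : 'I_3 -> 'M[R[i]]_N).
Hypothesis hS : so3_irreducible_generators S.
Variables (kappa : R) (I : set R) (W P : R -> 'M[R[i]]_N).
Hypothesis hWP : euler_zeitlin_dissipative_solution S kappa I W P.

Let quot t s := ((s - t)^-1)%:C *: (W s - W t).

Lemma quotE t s : W s - W t = (s - t)%:C *: quot t s.
Proof.
rewrite /quot scalerA -rmorphM /=; have [->|st] := eqVneq s t.
  by rewrite !subrr scaler0.
by rewrite mulfV ?scale1r // subr_eq0.
Qed.

Lemma energyE t : I t ->
  energy (W t) (P t) = - (2 * pi / N%:R)%:C * \tr (W t *m P t).
Proof.
by move=> /hWP[[Wsk _] _ _ _]; rewrite /energy Wsk mulNmx linearN /= mulrN mulNr.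
Qed.

Lemma laplacianE t : I t -> quantized_laplacian S (P t) = - W t.
Proof. by move=> /hWP[_ _ <- _]; rewrite opprK. Qed.

(** An exact discrete product rule: the limit then requires only the derivative of [W] and the
    continuity of [P]. *)
Lemma energy_quot t s : I t -> I s ->
  ((s - t)^-1)%:C * (energy (W s) (P s) - energy (W t) (P t)) =
  - (2 * pi / N%:R)%:C * \tr (quot t s *m (P s + P t)).
Proof.
move=> It Is; rewrite !energyE // -mulrBr mulrCA; congr (_ * _).
rewrite /quot -scalemxAl linearZ /=; congr (_ * _).
(* Symmetry of the Laplacian makes the two cross terms of the expanded product cancel. *)
have sym : \tr (W s *m P t) = \tr (W t *m P s).
  have := quantized_laplacian_sym S (P s) (P t).
  rewrite !laplacianE // mulNmx mulmxN [LHS]linearN [RHS]linearN.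
  by move=> /oppr_inj ->; rewrite mxtrace_mulC.
rewrite mulmxDr !mulmxBl !linearD !linearN /= sym.
by rewrite addrA subrK.
Qed.

Lemma stream_cvg t Wdot : I t ->
  cvg_entrywise (F := within I t^') (quot t) Wdot ->
  cvg_entrywise (F := within I t^') P (P t).
Proof.
move=> It qW; have [G PG] := quantized_laplacian_linv hS.
(* [psi] inverts the Laplacian on trace-free matrices. Applied to increments of [W], it gives P(s) =
   P(t) + (t - s) psi(quot t s), whose last term tends to 0 because [quot t s] converges. *)
pose psi : {linear 'M[R[i]]_N -> 'M[R[i]]_N} := vec_mx \o mulmxr G \o mxvec.
have PW s : I s -> P s = - psi (W s).
  move=> Is; have [_ [_ trP] _ _] := hWP Is.
  by rewrite -linearN -laplacianE //; exact: PG.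
apply: (cvg_entrywise_near
  (A := fun s => P t + (t - s)%:C *: psi (quot t s))).
  have : \forall s \near t^', I s -> I s by exact: nearW.
  apply: filterS => s _ Is; rewrite -(opprB s) rmorphN scaleNr -linearZ -quotE.
  by rewrite linearB !PW // opprB addKr.
rewrite -[P t in X in cvg_entrywise _ X]addr0 -(scale0r (psi Wdot)).
apply: cvg_entrywiseD; first exact: cvg_entrywise_cst.
apply: cvg_entrywiseZ; last first.
  apply: (cvg_entrywise_vec_mx (A := fun s => mxvec (quot t s) *m G)).
  apply: cvg_entrywise_mulmx; last exact: cvg_entrywise_cst.
  exact: cvg_entrywise_mxvec.
(* The first application drops the restriction to [I], the second the puncture at [t]. *)
apply: cvg_within_filter; apply: cvg_within_filter.
suff : (t - s)%:C @[s --> t] --> ((t - t)%:C : R[i]^o) by rewrite subrr.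
apply: (cvg_comp (fun s => t - s) (fun x => x%:C : R[i]^o)).
  by apply: cvgB; [exact: cvg_cst|exact: cvg_id].
exact: real_complex_continuous.
Qed.

Lemma energy_derivative0 t : I t ->
  ((s - t)^-1)%:C * (energy (W s) (P s) - energy (W t) (P t))
    @[s --> within I t^'] --> (0 : R[i]^o).
Proof.
move=> It; have [_ _ _ [Wdot dW eqW]] := hWP It.
have qW : cvg_entrywise (F := within I t^') (quot t) Wdot.
  move=> i j; apply: (cvg_comp (quot t) (fun A : 'M[R[i]^o]_N => A i j)).
    exact: dW.
  exact: coord_continuous.
(* Both terms of [Wdot] are multiples of some [lie A (P t)], with [A] equal to [W t] or to
   [lie (W t) (P t)]. *)
have WdotP : \tr (Wdot *m P t) = 0.
  have /(canRL (addrK _)) -> := eqW.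
  rewrite mulmxBl -!scalemxAl raddfB /= !mxtraceZ !mxtrace_lie_mul_self.
  by rewrite !mulr0 subrr.
have PP : cvg_entrywise (F := within I t^') (fun s => P s + P t) (P t + P t).
  by apply: cvg_entrywiseD; [exact: stream_cvg qW|exact: cvg_entrywise_cst].
have trWP : \tr (quot t s *m (P s + P t)) @[s --> within I t^'] --> (0 : R[i]^o).
  have := cvg_entrywise_mxtrace (cvg_entrywise_mulmx qW PP).
  by rewrite mulmxDr mxtraceD WdotP addr0; exact.
rewrite -(mulr0 (- (2 * pi / N%:R)%:C)).
apply: cvg_trans (cvgM (cvg_cst _) trWP); apply: near_eq_cvg.
(* The equations hold only at times in [I], so the quotient identity is used along the filter within
   [I]. *)
have : \forall s \near t^', I s -> I s by exact: nearW.
by apply: filterS => s _ Is; rewrite energy_quot.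
Qed.

End EnergyConservation.

Theorem proposition5p1 (R : realType) (N : nat) (hN : (2 <= N)%N)
    (S : 'I_3 -> 'M[R[i]]_N) (hS : so3_irreducible_generators S)
    (kappa : R) (hkappa : 0 <= kappa)
    (I : set R) (hI : is_interval I)
    (W P : R -> 'M[R[i]]_N)
    (hWP : euler_zeitlin_dissipative_solution S kappa I W P) :
  forall s t : R, I s -> I t -> energy (W s) (P s) = energy (W t) (P t).
Proof.
exact: within_derivative0_constC hI (energy_derivative0 hS hWP).
Qed.
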